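(* Let $A$ and $B$ be associative superalgebras over a field $\mathbb{K}$ of characteristic zero, let $B$ be an associative $A$-bimodule, and let $H:A\to B$ be a crossed homomorphism. Let $H_t=\sum_{i=0}^{\infty}t^iH_i$ be a formal one-parameter deformation of $H$. Then the infinitesimal $H_1$ is a $1$-cocycle in the cohomology of the crossed homomorphism $H$, i.e. $d_H(H_1)=0$.
   Context: An associative superalgebra is a $\mathbb{Z}_2$-graded vector space $A=A_0\oplus A_1$ with a bilinear associative product satisfying $A_iA_j\subseteq A_{i+j}$ (no unit is assumed). $|a|$ denotes the $\mathbb{Z}_2$-degree of a homogeneous element $a$. An even (degree $0$) linear map is one preserving the $\mathbb{Z}_2$-grading. For associative superalgebras $A,B$, ''$B$ is an associative $A$-bimodule'' means that there are degree $0$ bilinear maps $A\otimes B\to B$, $(a,x)\mapsto a\cdot x$, and $B\otimes A\to B$, $(x,a)\mapsto x\cdot a$, such that for all $a,b\in A$, $x,y\in B$: $(ab)\cdot x=a\cdot(b\cdot x)$, $(a\cdot x)\cdot b=a\cdot(x\cdot b)$, $(x\cdot a)\cdot b=x\cdot(ab)$, $(a\cdot x)y=a\cdot(xy)$, $(x\cdot a)y=x(a\cdot y)$, $(xy)\cdot a=x(y\cdot a)$. A crossed homomorphism $H:A\to B$ is a linear map of degree $0$ with $H(ab)=a\cdot H(b)+H(a)\cdot b+H(a)H(b)$ for all homogeneous $a,b\in A$. Cochains: $C^n(A,B)=\mathrm{Hom}(A^{\otimes n},B)$. A homogeneous $f\in C^m(A,B)$ has bidegree $(m,\alpha_f)$,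 where $|f(a_1,\dots,a_m)|=\alpha_f+|a_1|+\cdots+|a_m|$ for homogeneous $a_i$. For homogeneous $f\in C^m(A,B)$, $g\in C^n(A,B)$, $$[\![f,g]\!]_1(a_1,\dots,a_{m+n})=(-1)^{\alpha_f\alpha_g+\alpha_f(|a_1|+\cdots+|a_n|)}\,g(a_1,\dots,a_n)\,f(a_{n+1},\dots,a_{m+n})+(-1)^{mn+1+\alpha_g(|a_1|+\cdots+|a_m|)}\,f(a_1,\dots,a_m)\,g(a_{m+1},\dots,a_{m+n}),$$ $$(df)(a_1,\dots,a_{m+1})=(-1)^{m-1+\alpha_f|a_1|}a_1\cdot f(a_2,\dots,a_{m+1})+f(a_1,\dots,a_m)\cdot a_{m+1}-(-1)^{m-1}\sum_{i=1}^{m}(-1)^{i-1}f(a_1,\dots,a_{i-1},a_ia_{i+1},a_{i+2},\dots,a_{m+1}),$$ and $d_H=d+[\![H,-]\!]_1$. A $k$-cocycle is an $f\in C^k(A,B)$ with $d_Hf=0$. $A[[t]]$ and $B[[t]]$ denote formal power series with coefficients in $A$ and $B$; they are associative superalgebras and $B[[t]]$ is an associative $A[[t]]$-bimodule, with all operations extended $t$-linearly. A formal one-parameter deformation of $H$ is a map $H_t=\sum_{i\ge0}t^iH_i:A[[t]]\to B[[t]]$ with $H_0=H$ and each $H_i:A\to B$ an even linear map, such that $H_t(xy)=H_t(x)\cdot y+x\cdot H_t(y)+H_t(x)H_t(y)$ for all homogeneous $x,y\in A$. Its infinitesimal is $H_1$. *)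

(* Defs.v *)
From mathcomp Require Import all_boot all_order all_algebra.
From mathcomp Require Import sesquilinear.
From mathcomp Require Import zify.

Set Implicit Arguments.
Unset Strict Implicit.
Unset Printing Implicit Defensive.

Import GRing.Theory.
Local Open Scope ring_scope.

(* Z/2-degrees are booleans (false = 0, true = 1) and are added with [(+)].
   [part] carries no information beyond [deg]: it is the (unique)
   decomposition V = V_0 (+) V_1 along the subspaces V_i = [deg i]. *)
Record superspace (K : fieldType) := SuperSpace {
  ss_sort :> lmodType K;
  deg : bool -> ss_sort -> Prop;
  deg0 : forall i, deg i 0;
  degP : forall i c u v, deg i u -> deg i v -> deg i (c *: u + v);
  deg_disj : forall v, deg false v -> deg true v -> v = 0;
  part : bool -> ss_sort -> ss_sort;
  part_deg : forall i v, deg i (part i v);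
  part_sum : forall v, v = part false v + part true v
}.

Record superalgebra (K : fieldType) := SuperAlgebra {
  sa_space :> superspace K;
  smul : {bilinear sa_space -> sa_space -> sa_space};
  smulA : forall a b c, smul a (smul b c) = smul (smul a b) c;
  smul_deg : forall i j a b, deg i a -> deg j b -> deg (i (+) j) (smul a b)
}.

Arguments smul {K s}.

Record bimodule (K : fieldType) (A B : superalgebra K) := Bimodule {
  lact : {bilinear A -> B -> B};
  ract : {bilinear B -> A -> B};
  lact_deg : forall i j a x, deg i a -> deg j x -> deg (i (+) j) (lact a x);
  ract_deg : forall i j x a, deg i x -> deg j a -> deg (i (+) j) (ract x a);
  lactA : forall a b x, lact (smul a b) x = lact a (lact b x);
  lractA : forall a x b, ract (lact a x) b = lact a (ract x b);
  ractA : forall x a b, ract (ract x a) b = ract x (smul a b);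
  lact_smul : forall a x y, smul (lact a x) y = lact a (smul x y);
  ract_lact : forall x a y, smul (ract x a) y = smul x (lact a y);
  smul_ract : forall x y a, ract (smul x y) a = smul x (ract y a)
}.

Definition homogeneous (K : fieldType) (V : superspace K) (v : V) : Prop :=
  exists i, deg i v.

Definition even_map (K : fieldType) (V W : superspace K) (f : V -> W) : Prop :=
  forall i v, deg i v -> deg i (f v).

Definition crossed_hom (K : fieldType) (A B : superalgebra K)
    (M : bimodule A B) (H : {linear A -> B}) : Prop :=
  even_map H /\
  forall a b : A, homogeneous a -> homogeneous b ->
    H (smul a b) = lact M a (H b) + ract M (H a) b + smul (H a) (H b).

Section Multilinear.
Context (K : fieldType).

Definition upd (V : Type) n (a : {ffun 'I_n -> V}) (i : 'I_n) (x : V) :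
    {ffun 'I_n -> V} :=
  [ffun j => if j == i then x else a j].

Definition multilinear (V W : lmodType K) n (f : {ffun 'I_n -> V} -> W) : Prop :=
  forall (i : 'I_n) (a : {ffun 'I_n -> V}), linear (fun x => f (upd a i x)).

Definition subargs (V : Type) k n (s : 'I_k -> 'I_n) (a : {ffun 'I_n -> V}) :
    {ffun 'I_k -> V} :=
  [ffun j => a (s j)].

Lemma upd_id (V : Type) n (a : {ffun 'I_n -> V}) i : upd a i (a i) = a.
Proof. by apply/ffunP => j; rewrite ffunE; case: eqP => // ->. Qed.

Lemma subargs_upd (V : Type) k n (s : 'I_k -> 'I_n) (a : {ffun 'I_n -> V}) j x :
  injective s -> subargs s (upd a (s j) x) = upd (subargs s a) j x.
Proof. by move=> sI; apply/ffunP => l; rewrite !ffunE (inj_eq sI). Qed.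

Lemma subargs_upd_out (V : Type) k n (s : 'I_k -> 'I_n) (a : {ffun 'I_n -> V}) i x :
  (forall j, s j != i) -> subargs s (upd a i x) = subargs s a.
Proof. by move=> sN; apply/ffunP => l; rewrite !ffunE (negPf (sN l)). Qed.

Lemma multilinear_comp (V W : lmodType K) m n (f : {ffun 'I_m -> V} -> W)
    (T : {ffun 'I_n -> V} -> {ffun 'I_m -> V}) :
  multilinear f ->
  (forall i a, exists j b (phi : V -> V),
     linear phi /\ forall x, T (upd a i x) = upd b j (phi x)) ->
  multilinear (fun a => f (T a)).
Proof.
move=> fM TP i a c u v; have [j [b [phi [phiL TE]]]] := TP i a.
by rewrite !TE phiL fM.
Qed.

Lemma multilinearD (V W : lmodType K) n (f g : {ffun 'I_n -> V} -> W) :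
  multilinear f -> multilinear g -> multilinear (fun a => f a + g a).
Proof. by move=> fM gM i a c u v; rewrite fM gM scalerDr addrACA. Qed.

Lemma multilinearZ (V W : lmodType K) n (k : K) (f : {ffun 'I_n -> V} -> W) :
  multilinear f -> multilinear (fun a => k *: f a).
Proof. by move=> fM i a c u v; rewrite fM scalerDr !scalerA mulrC. Qed.

Lemma multilinearN (V W : lmodType K) n (f : {ffun 'I_n -> V} -> W) :
  multilinear f -> multilinear (fun a => - f a).
Proof. by move=> fM i a c u v; rewrite fM opprD scalerN. Qed.

Lemma multilinear_sum (V W : lmodType K) n (I : finType)
    (f : I -> {ffun 'I_n -> V} -> W) :
  (forall k, multilinear (f k)) -> multilinear (fun a => \sum_k f k a).
Proof.
move=> fM i a c u v; rewrite scaler_sumr -big_split /=.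
by apply: eq_bigr => k _; rewrite fM.
Qed.

Lemma multilinear_op (V W X Y : lmodType K) m n N (op : {bilinear W -> X -> Y})
    (s : 'I_m -> 'I_N) (t : 'I_n -> 'I_N)
    (f : {ffun 'I_m -> V} -> W) (g : {ffun 'I_n -> V} -> X) :
  injective s -> injective t ->
  (forall i, (exists j, s j = i) \/ (exists j, t j = i)) ->
  (forall j k, s j != t k) ->
  multilinear f -> multilinear g ->
  multilinear (fun a => op (f (subargs s a)) (g (subargs t a))).
Proof.
move=> sI tI cov dis fM gM i a c u v.
case: (cov i) => [[j <-]|[j <-]].
  rewrite !subargs_upd // !(@subargs_upd_out _ _ _ t) => [|k|k|k];
    rewrite 1?eq_sym ?dis //.
  by rewrite fM linearPl.
by rewrite !subargs_upd // !(@subargs_upd_out _ _ _ s) // gM linearPr.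
Qed.

Lemma multilinear0 (V W : lmodType K) n (f : {ffun 'I_n -> V} -> W)
    (a : {ffun 'I_n -> V}) i :
  multilinear f -> a i = 0 -> f a = 0.
Proof.
move=> fM ai0; rewrite -(upd_id a i) ai0.
by have := fM i a (-1) 0 0; rewrite scaler0 addr0 scaleN1r addNr.
Qed.

End Multilinear.

Section Parts.
Context (K : fieldType) (V : superspace K).

Lemma degD i (u v : V) : deg i u -> deg i v -> deg i (u + v).
Proof. by move=> du dv; rewrite -[u]scale1r; apply: degP. Qed.

Lemma degZ i c (u : V) : deg i u -> deg i (c *: u).
Proof. by move=> du; rewrite -[_ *: _]addr0; apply/degP/deg0. Qed.

Lemma part_uniq (u0 u1 v0 v1 : V) :
  deg false u0 -> deg true u1 -> deg false v0 -> deg true v1 ->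
  u0 + u1 = v0 + v1 -> u0 = v0 /\ u1 = v1.
Proof.
move=> du0 du1 dv0 dv1 E.
have E' : u0 - v0 = v1 - u1.
  by apply/eqP; rewrite subr_eq addrAC [v1 + v0]addrC -E addrK.
have d0 : deg false (u0 - v0) by rewrite -scaleN1r; apply/degD/degZ.
have d1 : deg true (u0 - v0) by rewrite E' -scaleN1r; apply/degD/degZ.
have Z := deg_disj d0 d1; split; first exact/subr0_eq.
by apply/esym/subr0_eq; rewrite -E'.
Qed.

Lemma part_linear i : linear (@part K V i).
Proof.
move=> c u v; have dP j := degP c (part_deg j u) (part_deg j v).
have [|E0 E1] := part_uniq (part_deg false (c *: u + v))
  (part_deg true (c *: u + v)) (dP false) (dP true).
  by rewrite -part_sum addrACA -scalerDr -!part_sum.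
by case: i.
Qed.

Lemma part_homog i j (v : V) :
  deg i v -> part j v = if j == i then v else 0.
Proof.
move=> dv.
have d0 : deg false (if i then 0 else v).
  by case: i dv => // _; apply: deg0.
have d1 : deg true (if i then v else 0).
  by case: i dv {d0} => // _; apply: deg0.
have [|E0 E1] := part_uniq (part_deg false v) (part_deg true v) d0 d1.
  by rewrite -part_sum; case: i {dv d0 d1}; rewrite ?add0r ?addr0.
by case: i j E0 E1 {dv d0 d1} => [] [] /=.
Qed.

End Parts.

Section Cochains.
Context (K : fieldType) (A B : superalgebra K).

(* Linear maps on the n-th tensor power of A are multilinear maps in n
   variables; the argument a_(i+1) is [a i] for i : 'I_n. *)
Record cochain (n : nat) := Cochain {
  cfun :> {ffun 'I_n -> A} -> B;
  cfunP : multilinear cfun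
}.

Lemma cochain1_subproof (f : {linear A -> B}) :
  multilinear (fun a : {ffun 'I_1 -> A} => f (a ord0)).
Proof. by move=> i a c u v; rewrite !ffunE (ord1 i) eqxx linearP. Qed.

Definition cochain1 (f : {linear A -> B}) : cochain 1 :=
  Cochain (@cochain1_subproof f).

Definition parity n (p : {ffun 'I_n -> bool}) : bool := odd (\sum_(i < n) p i)%N.

Definition homog_cochain n (alpha : bool) (f : cochain n) : Prop :=
  forall (p : {ffun 'I_n -> bool}) (a : {ffun 'I_n -> A}),
    (forall i, deg (p i) (a i)) -> deg (alpha (+) parity p) (f a).

Definition parts n (p : {ffun 'I_n -> bool}) (a : {ffun 'I_n -> A}) :
    {ffun 'I_n -> A} :=
  [ffun i => part (p i) (a i)].

(* Multilinear extension of a formula F p valid on tuples of homogeneous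
   arguments of respective degrees p. *)
Definition extend n (F : {ffun 'I_n -> bool} -> {ffun 'I_n -> A} -> B)
    (a : {ffun 'I_n -> A}) : B :=
  \sum_(p : {ffun 'I_n -> bool}) F p (parts p a).

Lemma parts_upd n p (a : {ffun 'I_n -> A}) i x :
  parts p (upd a i x) = upd (parts p a) i (part (p i) x).
Proof. by apply/ffunP => j; rewrite !ffunE; case: eqP => // ->. Qed.

Lemma parts_multilinear n p (f : {ffun 'I_n -> A} -> B) :
  multilinear f -> multilinear (fun a => f (parts p a)).
Proof.
move=> fM; apply: multilinear_comp fM _ => i a.
exists i, (parts p a), (@part K A (p i)); split; first exact: part_linear.
by move=> x; rewrite parts_upd.
Qed.

Lemma extend_multilinear n (F : {ffun 'I_n -> bool} -> {ffun 'I_n -> A} -> B) :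
  (forall p, multilinear (F p)) -> multilinear (extend F).
Proof. by move=> FM; apply: multilinear_sum => p; apply: parts_multilinear. Qed.

Lemma extend_homog n (F : {ffun 'I_n -> bool} -> {ffun 'I_n -> A} -> B)
    (p : {ffun 'I_n -> bool}) (a : {ffun 'I_n -> A}) :
  (forall q, multilinear (F q)) -> (forall i, deg (p i) (a i)) ->
  extend F a = F p a.
Proof.
move=> FM da; rewrite /extend (bigD1 p) //= big1 => [|q qp].
  rewrite addr0; congr (F p _); apply/ffunP => i.
  by rewrite ffunE (part_homog _ (da i)) eqxx.
have [i qi] : exists i, q i != p i.
  by apply/existsP; rewrite -negb_forall; apply: contra qp => /forallP E;
     apply/eqP/ffunP => i; apply/eqP.
by apply: (multilinear0 (i := i)) => //; rewrite ffunE (part_homog _ (da i))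
  (negPf qi).
Qed.

Lemma comp_cochain_subproof n alpha (f : cochain n) :
  multilinear (extend (fun p a => part (alpha (+) parity p) (f a))).
Proof.
by apply: extend_multilinear => p i a c u v; rewrite cfunP part_linear.
Qed.

Definition comp_cochain n (alpha : bool) (f : cochain n) : cochain n :=
  Cochain (@comp_cochain_subproof n alpha f).

Definition contract m (i : 'I_m) (a : {ffun 'I_m.+1 -> A}) : {ffun 'I_m -> A} :=
  [ffun j : 'I_m =>
     if (j < i)%N then a (widen_ord (leqnSn m) j)
     else if j == i then smul (a (widen_ord (leqnSn m) i)) (a (lift ord0 i))
     else a (lift ord0 j)].

Lemma contract_upd m (i : 'I_m) k (a : {ffun 'I_m.+1 -> A}) :
  exists j b (phi : A -> A), linear phi /\
    forall x, contract i (upd a k x) = upd b j (phi x).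
Proof.
have E (l : 'I_m) : (widen_ord (leqnSn m) l == k) = (l == k :> nat) by [].
have E' (l : 'I_m) : (lift ord0 l == k) = (l.+1 == k :> nat) by [].
have [ki|ik|ki] := ltngtP k i.
- have km : (k < m)%N := ltn_trans ki (ltn_ord i).
  exists (Ordinal km), (contract i a), id; split=> // x.
  apply/ffunP => j; rewrite !ffunE !E !E' -[j == Ordinal _]/(j == k :> nat).
  rewrite -[j == i]/(j == i :> nat).
  by case: (ltngtP j i) => ?; repeat (case: eqP => ? //=); try lia.
- have [ki|ki] := eqVneq (k : nat) i.+1.
    exists i, (contract i a), (smul (a (widen_ord (leqnSn m) i))).
    split=> [c u v|x]; first by rewrite linearPr.
    apply/ffunP => j; rewrite !ffunE !E !E' ki -[j == i]/(j == i :> nat).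
    by case: (ltngtP j i) => ?; repeat (case: eqP => ? //=); try lia.
  have km : (k.-1 < m)%N by have := ltn_ord k; lia.
  exists (Ordinal km), (contract i a), id; split=> // x.
  apply/ffunP => j; rewrite !ffunE !E !E' -[j == Ordinal _]/(j == k.-1 :> nat).
  rewrite -[j == i]/(j == i :> nat).
  by case: (ltngtP j i) => ?; repeat (case: eqP => ? //=); try lia.
exists i, (contract i a), (fun x => smul x (a (lift ord0 i))).
split=> [c u v|x]; first by rewrite linearPl.
apply/ffunP => j; rewrite !ffunE !E !E' ki -[j == i]/(j == i :> nat).
by case: (ltngtP j i) => ?; repeat (case: eqP => ? //=); try lia.
Qed.

Lemma contract_homog m (i : 'I_m) (p : {ffun 'I_m.+1 -> bool})
    (a : {ffun 'I_m.+1 -> A}) :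
  (forall k, deg (p k) (a k)) ->
  exists q : {ffun 'I_m -> bool}, forall j, deg (q j) (contract i a j).
Proof.
move=> da.
exists [ffun j : 'I_m =>
   if (j < i)%N then p (widen_ord (leqnSn m) j)
   else if j == i then p (widen_ord (leqnSn m) i) (+) p (lift ord0 i)
   else p (lift ord0 j)] => j.
by rewrite !ffunE; case: ifP => // _; case: ifP => // _; apply: smul_deg.
Qed.

(* On homogeneous arguments, [comp_cochain alpha f] is f if f has degree alpha
   and vanishes if f has the other degree. *)
Lemma comp_cochain_homog n alpha beta (f : cochain n)
    (p : {ffun 'I_n -> bool}) (a : {ffun 'I_n -> A}) :
  homog_cochain alpha f -> (forall i, deg (p i) (a i)) ->
  comp_cochain beta f a = if beta == alpha then f a else 0.
Proof.
move=> fh da; rewrite /= (extend_homog (p := p)) //.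
  rewrite (part_homog _ (fh _ _ da)).
  by rewrite (inj_eq (@addIb _)).
by move=> q i b c u v; rewrite cfunP part_linear.
Qed.

Lemma cochain_add_subproof n (f g : cochain n) :
  multilinear (fun a => f a + g a).
Proof. by apply: multilinearD; apply: cfunP. Qed.

Definition cochain_add n (f g : cochain n) : cochain n :=
  Cochain (@cochain_add_subproof n f g).

(* The value of [[f, g]]_1 at homogeneous arguments a_i of degrees p_i, for f, g
   homogeneous of degrees alpha, beta. *)
Definition bracket_form m n (alpha beta : bool) (f : cochain m) (g : cochain n)
    (p : {ffun 'I_(m + n) -> bool}) (a : {ffun 'I_(m + n) -> A}) : B :=
  let fst_n (i : 'I_n) : 'I_(m + n) := cast_ord (addnC n m) (lshift m i) in
  let lst_m (i : 'I_m) : 'I_(m + n) := cast_ord (addnC n m) (rshift n i) in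
  let fst_m (i : 'I_m) : 'I_(m + n) := lshift n i in
  let lst_n (i : 'I_n) : 'I_(m + n) := rshift m i in
  (-1) ^+ (alpha * beta + alpha * \sum_(i < n) p (fst_n i))
    *: smul (g (subargs fst_n a)) (f (subargs lst_m a))
  + (-1) ^+ (m * n + 1 + beta * \sum_(i < m) p (fst_m i))
    *: smul (f (subargs fst_m a)) (g (subargs lst_n a)).

Lemma bracket_form_multilinear m n alpha beta (f : cochain m) (g : cochain n) p :
  multilinear (bracket_form alpha beta f g p).
Proof.
have cI := @cast_ord_inj _ _ (addnC n m).
have cov k l (i : 'I_(k + l)) :
    (exists j, lshift l j = i) \/ (exists j, rshift k j = i).
  rewrite -[i]splitK; case: (split i) => j; [left|right]; by exists j.
apply: multilinearD; apply: multilinearZ; apply: multilinear_op;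
  try exact: cfunP.
- by move=> x y /cI/lshift_inj.
- by move=> x y /cI/rshift_inj.
- move=> i; have [[j E]|[j E]] := cov n m (cast_ord (addnC m n) i).
    by left; exists j; rewrite E cast_ord_comp cast_ord_id.
  by right; exists j; rewrite E cast_ord_comp cast_ord_id.
- by move=> j k; rewrite (inj_eq cI) eq_lrshift.
- exact: lshift_inj.
- exact: rshift_inj.
- exact: cov.
- by move=> j k; rewrite eq_lrshift.
Qed.

Lemma bracket_subproof m n (f : cochain m) (g : cochain n) :
  multilinear (fun a => \sum_(alpha : bool) \sum_(beta : bool)
    extend (bracket_form alpha beta (comp_cochain alpha f)
                                    (comp_cochain beta g)) a).
Proof.
do 2![apply: multilinear_sum => ?]; apply: extend_multilinear => p.
exact: bracket_form_multilinear.
Qed.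

Definition bracket m n (f : cochain m) (g : cochain n) : cochain (m + n) :=
  Cochain (bracket_subproof f g).

Lemma bracket_homog m n alpha beta (f : cochain m) (g : cochain n)
    (p : {ffun 'I_(m + n) -> bool}) (a : {ffun 'I_(m + n) -> A}) :
  homog_cochain alpha f -> homog_cochain beta g ->
  (forall i, deg (p i) (a i)) ->
  bracket f g a = bracket_form alpha beta f g p a.
Proof.
move=> fh gh da /=.
have ds k (s : 'I_k -> 'I_(m + n)) j : deg (subargs s p j) (subargs s a j).
  by rewrite !ffunE.
have E al be : extend (bracket_form al be (comp_cochain al f)
    (comp_cochain be g)) a =
    if (al == alpha) && (be == beta) then bracket_form alpha beta f g p a else 0.
  rewrite (extend_homog (p := p)) //; last first.
    by move=> q; apply: bracket_form_multilinear.
  rewrite /bracket_form !(comp_cochain_homog _ fh (ds _ _)).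
  rewrite !(comp_cochain_homog _ gh (ds _ _)).
  case: (al =P alpha) => [->|_] /=; last first.
    by rewrite linear0r linear0l !scaler0 addr0.
  by case: eqP => [->|_] //=; rewrite linear0l linear0r !scaler0 addr0.
under eq_bigr => al _ do under eq_bigr => be _ do rewrite E.
rewrite (bigD1 alpha) //= [X in _ + X]big1 => [|i /negPf-> /=]; last first.
  by rewrite big1.
rewrite addr0 (bigD1 beta) //= !eqxx big1 ?addr0 //= => i /negPf->.
by [].
Qed.

Section Differential.
Context (M : bimodule A B).

(* The value of df at homogeneous arguments a_i of degrees p_i, for f homogeneous
   of degree alpha. The sign (-1)^(m-1) is written (-1)^(m+1), and the summation
   index i of [contract i] starts at 0. *)
Definition d_form m (alpha : bool) (f : cochain m)
    (p : {ffun 'I_m.+1 -> bool}) (a : {ffun 'I_m.+1 -> A}) : B :=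
  (-1) ^+ (m.+1 + alpha * p ord0)
    *: lact M (a ord0) (f (subargs (lift ord0) a))
  + ract M (f (subargs (widen_ord (leqnSn m)) a)) (a ord_max)
  - (-1) ^+ m.+1 *: \sum_(i < m) (-1) ^+ i *: f (contract i a).

Lemma d_form_multilinear m alpha (f : cochain m) p :
  multilinear (d_form alpha f p).
Proof.
have c1 k : multilinear (fun b : {ffun 'I_1 -> A} => b k).
  by move=> i a c u v; rewrite !ffunE (ord1 i) (ord1 k) eqxx.
have E1 (k : 'I_m.+1) (a : {ffun 'I_m.+1 -> A}) :
  a k = subargs (fun _ : 'I_1 => k) a ord0 by rewrite ffunE.
apply: multilinearD; first apply: multilinearD; first apply: multilinearZ.
- move=> i a c u v; rewrite !(E1 ord0); move: i a c u v.
  apply: (@multilinear_op _ _ _ _ _ _ _ _ _ _ _ (fun b => b ord0));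
    try exact: cfunP; try exact: c1.
  + by move=> x y _; rewrite !ord1.
  + exact: lift_inj.
  + move=> i; case: (unliftP ord0 i) => [j ->|->]; [right|left].
      by exists j.
    by exists ord0.
  + by move=> _ k; rewrite neq_lift.
- move=> i a c u v; rewrite !(E1 ord_max); move: i a c u v.
  apply: (@multilinear_op _ _ _ _ _ _ _ _ _ _ _ _ (fun b => b ord0));
    try exact: cfunP; try exact: c1.
  + by move=> x y /(congr1 val) E; apply: val_inj.
  + by move=> x y _; rewrite !ord1.
  + move=> i; have [im|im] := ltnP i m.
      by left; exists (Ordinal im); apply: val_inj.
    by right; exists ord0; apply: val_inj => /=; have := ltn_ord i; lia.
  + by move=> k _; rewrite -(inj_eq val_inj) /= neq_ltn ltn_ord.
- apply: multilinearN; apply: multilinearZ; apply: multilinear_sum => i; apply: multilinearZ.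
  by apply: multilinear_comp (cfunP f) _ => k a; apply: contract_upd.
Qed.

Lemma d_subproof m (f : cochain m) :
  multilinear (fun a => \sum_(alpha : bool)
    extend (d_form alpha (comp_cochain alpha f)) a).
Proof.
apply: multilinear_sum => ?; apply: extend_multilinear => p.
exact: d_form_multilinear.
Qed.

Definition d m (f : cochain m) : cochain m.+1 := Cochain (d_subproof f).

Lemma d_homog m alpha (f : cochain m)
    (p : {ffun 'I_m.+1 -> bool}) (a : {ffun 'I_m.+1 -> A}) :
  homog_cochain alpha f -> (forall i, deg (p i) (a i)) ->
  d f a = d_form alpha f p a.
Proof.
move=> fh da /=.
have ds k (s : 'I_k -> 'I_m.+1) j : deg (subargs s p j) (subargs s a j).
  by rewrite !ffunE.
have E al : extend (d_form al (comp_cochain al f)) a =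
    if al == alpha then d_form alpha f p a else 0.
  rewrite (extend_homog (p := p)) //; last first.
    by move=> q; apply: d_form_multilinear.
  rewrite /d_form !(comp_cochain_homog _ fh (ds _ _)).
  have cE i : comp_cochain al f (contract i a) =
      if al == alpha then f (contract i a) else 0.
    by have [q dq] := contract_homog i da; apply: comp_cochain_homog dq.
  under eq_bigr do rewrite cE.
  case: eqP => [->|_] //; rewrite linear0r linear0l scaler0 addr0 sub0r.
  by rewrite big1 => [|i _]; rewrite scaler0 ?oppr0.
under eq_bigr do rewrite E.
by rewrite (bigD1 alpha) //= eqxx big1 ?addr0 // => i /negPf->.
Qed.

Definition d_twisted (H : {linear A -> B}) m (f : cochain m) : cochain m.+1 :=
  cochain_add (d f) (bracket (cochain1 H) f).

Definition cocycle (H : {linear A -> B}) m (f : cochain m) : Prop :=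
  forall a, d_twisted H f a = 0.

End Differential.

End Cochains.

(* A formal power series over V is its sequence of coefficients. *)
Definition series (V : Type) := nat -> V.

Section Series.
Context (K : fieldType).

Definition seriesC (V : lmodType K) (v : V) : series V :=
  fun n => if n == 0%N then v else 0.

Definition series_add (V : lmodType K) (u v : series V) : series V :=
  fun n => u n + v n.

(* t-linear extension of a bilinear operation *)
Definition series_op (U V W : lmodType K) (op : U -> V -> W)
    (u : series U) (v : series V) : series W :=
  fun n => \sum_(i < n.+1) op (u i) (v (n - i)%N).

(* The t-linear map \sum_i t^i H_i from V[[t]] to W[[t]] *)
Definition series_map (V W : lmodType K) (H_ : nat -> {linear V -> W})
    (v : series V) : series W :=
  fun n => \sum_(i < n.+1) H_ i (v (n - i)%N).

End Series.

(* The deformation H_t is given by its coefficients H_i; the last clause is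
   an equality in B[[t]]. *)
Definition formal_deformation (K : fieldType) (A B : superalgebra K)
    (M : bimodule A B) (H : {linear A -> B}) (H_ : nat -> {linear A -> B}) :
    Prop :=
  [/\ H_ 0%N =1 H,
      forall i, even_map (H_ i)
    & forall x y : A, homogeneous x -> homogeneous y ->
        let Ht := series_map H_ in
        let xt := seriesC x in
        let yt := seriesC y in
        Ht (series_op smul xt yt)
        =1 series_add
             (series_add (series_op (ract M) (Ht xt) yt)
                         (series_op (lact M) xt (Ht yt)))
             (series_op smul (Ht xt) (Ht yt))].

Definition infinitesimal (K : fieldType) (A B : superalgebra K)
    (H_ : nat -> {linear A -> B}) : {linear A -> B} := H_ 1%N.

(* Main.v *)
Require Import Defs.
From mathcomp Require Import all_boot all_order all_algebra.

(** Comparing the coefficients of t in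
      H_t (x y) = H_t x . y + x . H_t y + (H_t x) (H_t y)
    for homogeneous x and y, with H_0 = H, gives
      H_1 (x y) = x . H_1 y + H_1 x . y + (H_1 x) (H y) + (H x) (H_1 y),
    which is [infinitesimal_rule]. As H and H_1 have degree 0, the signs of d
    and of the bracket do not depend on the degrees of x and y, and
    [d_twisted_cochain1] shows that (d_H H_1) (x, y) is the right-hand side
    minus the left-hand side. So the multilinear map d_H H_1 vanishes on
    homogeneous arguments, hence everywhere ([multilinear_eq0]). *)

Set Implicit Arguments.
Unset Strict Implicit.
Unset Printing Implicit Defensive.

Import GRing.Theory.
Local Open Scope ring_scope.

(** The arguments are split one at a time into their two components: the
    induction is on the number [k] of leading arguments that need not be
    homogeneous. *)
Lemma multilinear_eq0 (K : fieldType) (V : superspace K) (W : lmodType K) n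
    (f : {ffun 'I_n -> V} -> W) :
  multilinear f ->
  (forall a : {ffun 'I_n -> V}, (forall i : 'I_n, homogeneous (a i)) -> f a = 0) ->
  forall a, f a = 0.
Proof.
move=> fM f0 a.
have step k : forall b : {ffun 'I_n -> V},
    (forall i : 'I_n, (k <= i)%N -> homogeneous (b i)) -> f b = 0.
  elim: k => [|k IHk] b hb; first by apply: f0 => i; apply: hb.
  have [nk|kn] := leqP n k.
    by apply: IHk => i ki; have := leq_trans nk ki; rewrite leqNgt ltn_ord.
  pose i0 := Ordinal kn.
  have upd0 j : f (upd b i0 (part j (b i0))) = 0.
    apply: IHk => i ki; rewrite ffunE; case: eqP => [_|ne].
      by exists j; apply: part_deg.
    apply: hb; rewrite ltn_neqAle ki andbT.
    by apply/eqP => E; apply: ne; apply: val_inj.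
  rewrite -(upd_id b i0) (part_sum (b i0)) -[part false _]scale1r.
  by rewrite fM !upd0 scaler0 addr0.
by apply: (step n) => i; rewrite leqNgt ltn_ord.
Qed.

Section PowerSeries.
Context (K : fieldType).

Lemma series_map_const (V W : lmodType K) (H_ : nat -> {linear V -> W}) v n :
  series_map H_ (seriesC v) n = H_ n v.
Proof.
rewrite /series_map big_ord_recr /= subnn big1 ?add0r // => i _.
by rewrite /seriesC subn_eq0 leqNgt ltn_ord linear0.
Qed.

Context (U V W : lmodType K) (op : {bilinear U -> V -> W}).

Lemma series_op_constl u (v : series V) n :
  series_op op (seriesC u) v n = op u (v n).
Proof.
rewrite /series_op big_ord_recl /= subn0 big1 ?addr0 // => i _.
by rewrite linear0l.
Qed.

Lemma series_op_constr (u : series U) v n :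
  series_op op u (seriesC v) n = op (u n) v.
Proof.
rewrite /series_op big_ord_recr /= subnn big1 ?add0r // => i _.
by rewrite /seriesC subn_eq0 leqNgt ltn_ord linear0r.
Qed.

Lemma series_op1 (u : series U) (v : series V) :
  series_op op u v 1 = op (u 0%N) (v 1%N) + op (u 1%N) (v 0%N).
Proof. by rewrite /series_op !big_ord_recl big_ord0 addr0. Qed.

End PowerSeries.

Section CrossedHom.
Context (K : fieldType) (A B : superalgebra K) (M : bimodule A B).

(** This is the coefficient of t^1 in the defining equation of a deformation:
    the constant series x and y leave one term from each action, and the product
    (H_t x) (H_t y) contributes the two ways of writing 1 = i + j. *)
Lemma infinitesimal_rule (H : {linear A -> B}) (H_ : nat -> {linear A -> B})
    (x y : A) :
  formal_deformation M H H_ -> homogeneous x -> homogeneous y ->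
  H_ 1%N (smul x y) = lact M x (H_ 1%N y) + ract M (H_ 1%N x) y
                      + (smul (H_ 1%N x) (H y) + smul (H x) (H_ 1%N y)).
Proof.
case=> H0 _ Hmul hx hy; have := Hmul x y hx hy 1%N.
rewrite /series_add series_op_constr series_op_constl series_op1.
rewrite !series_map_const !H0 [ract _ _ _ + _]addrC [smul (H x) _ + _]addrC.
move=> <-.
(* The product of two constant series is a constant series. *)
rewrite -series_map_const /series_map.
apply: eq_bigr => i _; congr (H_ i _); rewrite series_op_constl /seriesC.
by case: ifP => // _; rewrite linear0r.
Qed.

Lemma cochain1_homog (f : {linear A -> B}) :
  even_map f -> homog_cochain false (cochain1 f).
Proof.
by move=> ev p a da; rewrite /parity big_ord1 oddb; apply: ev (da ord0).
Qed.

(** H and f have parity 0, so in the formulas for d and the bracket on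
    homogeneous arguments every exponent loses its terms in the degrees; for
    m = n = 1 the exponents that remain are even. *)
Lemma d_twisted_cochain1 (H f : {linear A -> B}) (a : {ffun 'I_2 -> A}) :
  even_map H -> even_map f -> (forall i : 'I_2, homogeneous (a i)) ->
  let x := a ord0 in let y := a ord_max in
  d_twisted M H (cochain1 f) a =
    lact M x (f y) + ract M (f x) y - f (smul x y)
    + (smul (f x) (H y) + smul (H x) (f y)).
Proof.
move=> evH evf ha x y.
have [q dq] := fin_all_exists ha.
have dp i : deg ([ffun j => q j] i) (a i) by rewrite ffunE.
have Ex (i : 'I_2) : i = 0%N :> nat -> a i = x.
  by move=> E; congr (a _); apply: val_inj.
have Ey (i : 'I_2) : i = 1%N :> nat -> a i = y.
  by move=> E; congr (a _); apply: val_inj.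
have hf := cochain1_homog evf; have hH := cochain1_homog evH.
rewrite [LHS]/= [X in X + _](d_homog _ hf dp) [X in _ + X](bracket_homog hH hf dp).
rewrite /d_form /bracket_form big_ord1 /= !ffunE /=.
rewrite !mul0n expr0 sqrrN expr1n !scale1r.
rewrite (Ex (widen_ord _ _)) // (Ey (lift _ _)) // (Ex (@lshift 1 1 _)) //.
by rewrite (Ey (@rshift 1 1 _)) // (Ex (cast_ord _ _)) // (Ey (cast_ord _ _)).
Qed.

End CrossedHom.

Theorem mainTheorem2 (K : fieldType) (charK0 : [pchar K]%R =i pred0)
    (A B : superalgebra K) (M : bimodule A B)
    (H : {linear A -> B}) (crossedH : crossed_hom M H)
    (H_ : nat -> {linear A -> B}) (defH : formal_deformation M H H_) :
  cocycle M H (cochain1 (infinitesimal H_)).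
Proof.
apply: multilinear_eq0 => [|a ha]; first exact: cfunP.
have [evH _] := crossedH; have [_ evH_ _] := defH.
rewrite d_twisted_cochain1 //; last exact: evH_.
by rewrite /infinitesimal (infinitesimal_rule defH) // addrAC subrr.
Qed.
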